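(* For any graphs $F$ and $H$, we have $\mathrm{rex}(n,H,F)=\Theta(n^{|V(H)|})$ (as $n\to\infty$, with $F$ and $H$ fixed) if and only if $F$ is not a subgraph of a blow-up of $H$ (that is, there is no blow-up of $H$ containing $F$ as a subgraph).
   Context: All graphs are finite and simple. $\mathcal{N}(H,G)$ denotes the number of (not necessarily induced) copies of $H$ in $G$. A graph is $F$-free if it does not contain $F$ as a (not necessarily induced) subgraph. For graphs $H,F$ and a positive integer $n$, $\mathrm{rex}(n,H,F):=\max\{\mathcal{N}(H,G): G \text{ is an } F\text{-free regular } n\text{-vertex graph}\}$. A blow-up of $H$ is a graph obtained by replacing each vertex of $H$ by an independent set of vertices and each edge $uv\in E(H)$ by a complete bipartite graph between the independent sets replacing $u$ and $v$. *)

(* Defs.v *)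
From HB Require Import structures.
From mathcomp Require Import all_boot.

Set Implicit Arguments.
Unset Strict Implicit.
Unset Printing Implicit Defensive.

(* A simple graph on the vertex set V is a set of two-element subsets of V;
   as a subtype of {set {set V}} it is itself a finType. *)
Record sgraph (V : finType) := SGraph {
  edges :> {set {set V}};
  _ : [forall e in edges, #|e| == 2] }.

HB.instance Definition _ (V : finType) := [isSub of sgraph V for @edges V].
HB.instance Definition _ (V : finType) := [Finite of sgraph V by <:].

Definition adj (V : finType) (G : sgraph V) : rel V :=
  fun x y => [set x; y] \in edges G.

Lemma edge_card (V : finType) (G : sgraph V) e : e \in edges G -> #|e| = 2.
Proof. by case: G => E /= /forall_inP GE /GE /eqP. Qed.

Lemma adj_irrefl (V : finType) (G : sgraph V) : irreflexive (adj G).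
Proof. by move=> x; apply/negP=> /edge_card; rewrite setUid cards1. Qed.

Lemma adj_sym (V : finType) (G : sgraph V) : symmetric (adj G).
Proof. by move=> x y; rewrite /adj setUC. Qed.

Definition degree (V : finType) (G : sgraph V) (x : V) : nat :=
  #|[set y | adj G x y]|.

Definition is_regular (V : finType) (G : sgraph V) : bool :=
  [forall x, forall y, degree G x == degree G y].

(* A subgraph of G is encoded by the pair of its vertex set and edge set. *)
Definition is_subgraph (V : finType) (S : {set V} * {set {set V}})
    (G : sgraph V) : bool :=
  (S.2 \subset edges G) && [forall e in S.2, e \subset S.1].

Definition isomorphic_to (V W : finType) (S : {set V} * {set {set V}})
    (H : sgraph W) : bool :=
  [exists f : {ffun W -> V},
    [&& injectiveb f, f @: [set: W] == S.1
      & [set f @: (e : {set W}) | e in edges H] == S.2]].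

Definition copies (W V : finType) (H : sgraph W) (G : sgraph V) :=
  [set S : {set V} * {set {set V}} | is_subgraph S G && isomorphic_to S H].

Definition num_copies (W V : finType) (H : sgraph W) (G : sgraph V) : nat :=
  #|copies H G|.

Definition contains (V W : finType) (G : sgraph V) (F : sgraph W) : bool :=
  copies F G != set0.

Lemma containsP (V W : finType) (G : sgraph V) (F : sgraph W) :
  reflect (exists2 f : W -> V, injective f & {homo f : x y / adj F x y >-> adj G x y})
          (contains G F).
Proof.
apply: (iffP (set0Pn _)) => [[S] | [f f_inj f_homo]].
  rewrite inE => /andP[/andP[/subsetP SG _] /existsP[f]].
  move=> /and3P[/injectiveP f_inj _ /eqP Sf]; exists f => // x y Fxy.
  apply: SG; rewrite -Sf; apply/imsetP; exists [set x; y] => //.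
  by rewrite imsetU1 imset_set1.
pose g := [ffun x => f x].
exists (g @: [set: W], [set g @: (e : {set W}) | e in edges F]).
rewrite inE; apply/andP; split; last first.
  apply/existsP; exists g; rewrite !eqxx !andbT.
  by apply/injectiveP => x y; rewrite !ffunE => /f_inj.
apply/andP; split => /=.
  apply/subsetP => _ /imsetP[e eF ->].
  have /eqP/cards2P[x [y [_ De]]] := edge_card eF.
  by rewrite De imsetU1 imset_set1 !ffunE; apply: f_homo; rewrite /adj -De.
by apply/forall_inP => _ /imsetP[e _ ->]; apply: imsetS; apply: subsetT.
Qed.

(* The maximum is over labelled graphs on the n vertices 'I_n, which represent
   all n-vertex graphs up to isomorphism.  It is 0 if no n-vertex regular
   graph is F-free. *)
Definition rex (n : nat) (WH WF : finType) (H : sgraph WH) (F : sgraph WF) :=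
  \max_(G : sgraph 'I_n | is_regular G && ~~ contains G F) num_copies H G.

Section Blowup.
Variables (W : finType) (H : sgraph W) (s : W -> nat).

Definition blowup_vertex : finType := {v : W & 'I_(s v)}.

Definition blowup_edges : {set {set blowup_vertex}} :=
  [set e : {set blowup_vertex} | [exists x : blowup_vertex,
    exists y : blowup_vertex, adj H (tag x) (tag y) && (e == [set x; y])]].

Lemma blowup_edges_card : [forall e in blowup_edges, #|e| == 2].
Proof.
apply/forall_inP => e; rewrite inE => /existsP[x /existsP[y /andP[Hxy /eqP->]]].
suff nxy : x != y by rewrite cards2 nxy.
by apply: contraTneq Hxy => ->; rewrite adj_irrefl.
Qed.

Definition blowup : sgraph blowup_vertex := SGraph blowup_edges_card.

Lemma adj_blowup (x y : blowup_vertex) :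
  adj blowup x y = adj H (tag x) (tag y).
Proof.
rewrite /adj /= inE; apply/existsP/idP => [[x' /existsP[y']] | Hxy]; last first.
  by exists x; apply/existsP; exists y; rewrite /adj Hxy eqxx.
case/andP=> Hxy' /eqP Exy.
have nxy': x' != y' by apply: contraTneq Hxy' => ->; rewrite adj_irrefl.
have := set21 x y; have := set22 x y; have := set21 x' y'; have := set22 x' y'.
rewrite -Exy !inE => /orP[]/eqP ey /orP[]/eqP ex; move: nxy' Hxy'.
all: rewrite ?ex ?ey ?eqxx // => _; rewrite ?(setUC [set _] [set tag x]) //.
by rewrite adj_sym.
Qed.

End Blowup.

(* Main.v *)
(* F embeds in a blow-up of H exactly when there is a homomorphism F -> H.

   If F embeds in a blow-up of H, then an F-free graph has o(n^|V(H)|) copies of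
   H: otherwise the set of embeddings of H would be a dense |V(H)|-partite
   hypergraph, so by Erdos' theorem it would contain a complete box
   A_1 x ... x A_k with large sides; injectivity of embeddings makes the A_i
   disjoint, so the box is a large blow-up of H, and it contains F.

   Conversely, suppose that there is no homomorphism F -> H and that H has an
   edge. The m-fold blow-up of H can be completed, for linear m, to a regular
   graph that still maps homomorphically to H. The remaining vertices, whose
   number may have either parity, carry a circulant graph of the same even degree
   that joins almost antipodal points; any |V(F)| of its vertices induce a
   bipartite graph, which maps to an edge of H. Hence a copy of F in the union
   would yield a homomorphism F -> H. *)

Require Import Defs.
From mathcomp Require Import all_boot zify.

Set Implicit Arguments.
Unset Strict Implicit.
Unset Printing Implicit Defensive.

(** * Copies and embeddings *)

Definition embeddings (W V : finType) (H : sgraph W) (G : sgraph V) :=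
  [set f : {ffun W -> V} |
    injectiveb f && [forall x, forall y, adj H x y ==> adj G (f x) (f y)]].

Definition copy_of (W V : finType) (H : sgraph W) (f : {ffun W -> V}) :
    {set V} * {set {set V}} :=
  (f @: [set: W], [set f @: (e : {set W}) | e in edges H]).

Lemma embeddingP (W V : finType) (H : sgraph W) (G : sgraph V)
    (f : {ffun W -> V}) :
  reflect (injective f /\ {homo f : x y / adj H x y >-> adj G x y})
          (f \in embeddings H G).
Proof.
rewrite inE; apply: (iffP andP) => [[/injectiveP fi /forallP fh]|[fi fh]].
  by split=> // x y; move/forallP/(_ y)/implyP: (fh x).
split; first exact/injectiveP.
by apply/forallP => x; apply/forallP => y; apply/implyP/fh.
Qed.

Lemma copiesE (W V : finType) (H : sgraph W) (G : sgraph V) :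
  copies H G = copy_of H @: embeddings H G.
Proof.
apply/setP => S; apply/idP/imsetP => [|[f /embeddingP[fi fh] ->]].
  rewrite inE => /andP[/andP[/subsetP SG _] /existsP[f]].
  move=> /and3P[/injectiveP fi /eqP S1 /eqP S2].
  exists f; last by rewrite /copy_of S1 S2 -surjective_pairing.
  apply/embeddingP; split=> // x y Hxy; apply: SG; rewrite -S2.
  by apply/imsetP; exists [set x; y]; rewrite // imsetU1 imset_set1.
rewrite inE; apply/andP; split; last first.
  by apply/existsP; exists f; rewrite !eqxx !andbT; apply/injectiveP.
apply/andP; split => /=.
  apply/subsetP => _ /imsetP[e eH ->].
  have /eqP/cards2P[x [y [_ De]]] := edge_card eH.
  by rewrite De imsetU1 imset_set1; apply: fh; rewrite /adj -De.
by apply/forall_inP => _ /imsetP[e _ ->]; apply: imsetS; apply: subsetT.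
Qed.

Lemma num_copies_le_embeddings (W V : finType) (H : sgraph W) (G : sgraph V) :
  num_copies H G <= #|embeddings H G|.
Proof. by rewrite /num_copies copiesE leq_imset_card. Qed.

Lemma rex_le (n : nat) (WH WF : finType) (H : sgraph WH) (F : sgraph WF) :
  rex n H F <= n ^ #|WH|.
Proof.
apply/bigmax_leqP => G _; apply: leq_trans (num_copies_le_embeddings _ _) _.
by apply: leq_trans (max_card _) _; rewrite card_ffun card_ord.
Qed.

(** Each choice [g] of one index per vertex gives an embedding. Its vertex set already determines
    [g], so different choices give different copies. *)
Lemma num_copies_ge (W V : finType) (H : sgraph W) (G : sgraph V) (m : nat)
    (e : W -> 'I_m -> V) :
  (forall u a v b, e u a = e v b -> u = v /\ a = b) ->
  (forall u a v b, adj H u v -> adj G (e u a) (e v b)) ->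
  m ^ #|W| <= num_copies H G.
Proof.
move=> e_inj e_adj; pose f (g : {ffun W -> 'I_m}) := [ffun u => e u (g u)].
have f_emb g : f g \in embeddings H G.
  apply/embeddingP; split=> [u v | u v Huv]; rewrite !ffunE; last exact: e_adj.
  by case/e_inj.
have copy_inj : injective (fun g => copy_of H (f g)).
  move=> g g' [Efg _]; apply/ffunP => u.
  have: e u (g u) \in f g @: [set: W].
    by apply/imsetP; exists u; rewrite ?inE // ffunE.
  by rewrite Efg => /imsetP[v _]; rewrite ffunE => /e_inj[<- ->].
have -> : m ^ #|W| = #|[set copy_of H (f g) | g : {ffun W -> 'I_m}]|.
  by rewrite card_imset // card_ffun card_ord.
rewrite /num_copies copiesE; apply: subset_leq_card.
by apply/subsetP => _ /imsetP[g _ ->]; apply: imset_f.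
Qed.

(** * The upper bound *)

Lemma leq_ffact (d t : nat) : (d - t) ^ t <= d ^_ t.
Proof.
rewrite ffact_prod -[X in _ ^ X]card_ord -prod_nat_const.
by apply: leq_prod => i _; apply: leq_sub2l; apply: ltnW.
Qed.

(* Kovari-Sos-Turan counting: double count the pairs of an injection T and a y
   completely joined to it, and take the T with the most y's. *)
Lemma dense_rel_box (V Y : finType) (P : V -> pred Y) (q t : nat) :
  0 < q -> 0 < t -> 4 * q * t <= #|V| ->
  #|V| * #|Y| <= q * \sum_y #|[set x | P x y]| ->
  exists2 T : 'I_t -> V, injective T &
    #|Y| <= 2 * q * (4 * q) ^ t * #|[set y | [forall i, P (T i) y]]|.
Proof.
move=> q0 t0 Vbig dense; set n := #|V| in Vbig dense *.
pose d y := #|[set x | P x y]|; pose good := [set y | n <= 2 * q * d y].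
have n0 : 0 < n by apply: leq_trans Vbig; rewrite !muln_gt0 q0 t0.
(* The other [y] account for at most half of the degree sum guaranteed by [dense]. *)
have card_good : #|Y| <= 2 * q * #|good|.
  have: 2 * q * \sum_y d y <= 2 * q * (#|good| * n) + #|Y| * n.
    rewrite (bigID (mem good)) /= mulnDr; apply: leq_add.
      rewrite leq_mul2l -sum_nat_const; apply/orP; right.
      by apply: leq_sum => y _; apply: max_card.
    rewrite big_distrr /= -sum_nat_const big_mkcond /=.
    by apply: leq_sum => y _; case: ifP => //; rewrite inE -ltnNge => /ltnW.
  move: dense; rewrite -/d; move: (\sum_y _) #|good| #|Y| => S g y dense up.
  by rewrite -(@leq_pmul2r n) //; lia.
pose E (T : {ffun 'I_t -> V}) := [set y | [forall i, P (T i) y]].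
pose I := [set T : {ffun 'I_t -> V} | injectiveb T].
have cardI : #|I| <= n ^ t.
  by apply: leq_trans (max_card _) _; rewrite card_ffun card_ord.
have I0 : 0 < #|I| by rewrite card_inj_ffuns card_ord ffact_gt0 -/n; nia.
have [T TI maxT] := eq_bigmax_cond (fun T => #|E T|) I0.
exists T; first by apply/injectiveP; rewrite inE in TI.
rewrite -(@leq_pmul2r (n ^ t)) ?expn_gt0 ?n0 // -/(E T).
have sumE : \sum_(T in I) #|E T| = \sum_y d y ^_ t.
  under eq_bigr => T' _ do rewrite -sum1_card big_mkcond /=.
  rewrite exchange_big /=; apply: eq_bigr => y _.
  have := card_inj_ffuns_on 'I_t [pred x | P x y].
  rewrite card_ord; have -> : #|[pred x | P x y]| = d y by rewrite /d cardsE.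
  move=> <-.
  rewrite -sum1_card -big_mkcondr /=; apply: eq_bigl => T'; rewrite !inE andbC.
  congr (_ && _); apply/forallP/ffun_onP => h i; have := h i; by rewrite inE.
have upper : \sum_(T in I) #|E T| <= n ^ t * #|E T|.
  apply: leq_trans (_ : \sum_(T' in I) #|E T| <= _).
    apply: leq_sum => T' T'I; rewrite -maxT.
    exact: (leq_bigmax_cond (F := fun T => #|E T|)).
  by rewrite sum_nat_const leq_mul2r cardI orbT.
(* For good [y], [n <= 2 * q * d y] and [4 * q * t <= n] give [n <= 4 * q * (d y - t)]. *)
have lower : #|good| * n ^ t <= (4 * q) ^ t * \sum_y d y ^_ t.
  rewrite (bigID (mem good)) /= mulnDr -sum_nat_const big_distrr /=.
  apply: leq_trans (leq_addr _ _); apply: leq_sum => y; rewrite inE => gy.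
  apply: leq_trans (leq_mul (leqnn _) (leq_ffact _ _)).
  by rewrite -expnMn leq_exp2r //; nia.
move: upper lower card_good; rewrite sumE; set S := \sum_y _.
set e := (4 * q) ^ t; set N := n ^ t; set g := #|good|; set z := #|E T|.
move=> upper lower card_good.
apply: leq_trans (_ : 2 * q * g * N <= _);
  first by rewrite leq_mul2r card_good orbT.
apply: leq_trans (_ : 2 * q * (e * (N * z)) <= _); last by lia.
rewrite -mulnA leq_mul2l; apply/orP; right; apply: leq_trans lower _.
by rewrite leq_mul2l upper orbT.
Qed.

(** Swapping [x] with the value [f v] is an involution on pairs, and the left side counts the pairs
    that it moves into [setX [set: V] E]. *)
Lemma sum_card_update (W V : finType) (v : W) (E : {set {ffun W -> V}}) :
  \sum_(f : {ffun W -> V}) #|[set x | [ffun u => if u == v then x else f u] \in E]| =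
  #|V| * #|E|.
Proof.
pose upd (p : V * {ffun W -> V}) : V * {ffun W -> V} :=
  (p.2 v, [ffun u => if u == v then p.1 else p.2 u]).
have updK : involutive upd.
  move=> [x f]; rewrite /upd /= ffunE eqxx; congr (_, _); apply/ffunP => u.
  by rewrite !ffunE; case: eqP => // ->.
have := card_preimset (setX [set: V] E) (inv_inj updK).
rewrite cardsX cardsT => <-.
under eq_bigr => f _ do rewrite -sum1_card big_mkcond /=.
rewrite -sum1_card exchange_big pair_big /= [RHS]big_mkcond /=.
by apply: eq_bigr => -[x f] _; rewrite !inE.
Qed.

(* Erdos' theorem on complete k-partite k-uniform hypergraphs, by treating the
   coordinates in l one at a time. *)
Lemma dense_box (W : finType) (t q : nat) (l : seq W) :
  0 < t -> 0 < q -> uniq l ->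
  exists N q' : nat, 0 < q' /\
  forall (V : finType) (E : {set {ffun W -> V}}),
    N <= #|V| -> #|V| ^ #|W| <= q * #|E| ->
    exists A : W -> 'I_t -> V, (forall v, v \in l -> injective (A v)) /\
      #|V| ^ #|W| <= q' * #|[set f : {ffun W -> V} |
        [forall j : {ffun W -> 'I_t},
          [ffun v => if v \in l then A v (j v) else f v] \in E]]|.
Proof.
move=> t0 q0; elim: l => [_ | v l IHl /= /andP[vl ul]].
  exists 1, q; split=> // V E V0 denseE.
  have /card_gt0P[x _] := V0; exists (fun _ _ => x); split=> //.
  apply: leq_trans denseE _; rewrite leq_mul2l; apply/orP; right.
  apply: subset_leq_card; apply/subsetP => f fE; rewrite inE; apply/forallP => j.
  by rewrite (_ : finfun _ = f) //; apply/ffunP => u; rewrite ffunE.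
have [N [q' [q'0 IH]]] := IHl ul.
exists (maxn N (4 * q' * t)), (2 * q' * (4 * q') ^ t); split.
  by rewrite !muln_gt0 expn_gt0 muln_gt0 q'0.
move=> V E; rewrite geq_max => /andP[NV tV] /(IH V E NV)[A [Ainj]].
set E1 := [set f | _] => denseE1.
(* By [sum_card_update] this relation is as dense as [E1]; the injection found for it supplies the
   [t] values at [v]. *)
pose P x f := [ffun u => if u == v then x else f u] \in E1.
have [|T Tinj denseT] := @dense_rel_box V {ffun W -> V} P q' t q'0 t0 tV.
  by rewrite sum_card_update card_ffun mulnCA leq_mul2l denseE1 orbT.
exists (fun u => if u == v then T else A u); split.
  by move=> u; rewrite inE; case: eqP => //= _ /Ainj.
rewrite card_ffun in denseT; apply: leq_trans denseT _.
rewrite leq_mul2l; apply/orP; right; apply: subset_leq_card.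
apply/subsetP => f; rewrite !inE => /forallP fP; apply/forallP => j.
move: (fP (j v)); rewrite /P inE => /forallP/(_ j).
congr (_ \in E); apply/ffunP => u; rewrite !ffunE inE.
by case: eqP => [->|] //=; rewrite (negPf vl).
Qed.

Lemma rex_small (WH WF : finType) (H : sgraph WH) (F : sgraph WF)
    (s : WH -> nat) (q : nat) :
  contains (blowup H s) F -> 0 < q ->
  exists N, forall n, N <= n -> q * rex n H F < n ^ #|WH|.
Proof.
(* [t] bounds every part of the blow-up, and the successor keeps it positive. *)
move=> /containsP[g g_inj g_hom] q0; pose t := (\max_v s v).+1.
have s_lt v : s v <= t by apply: leqW; apply: leq_bigmax.
have [N [q' [q'0 box]]] := dense_box (ltn0Sn _ : 0 < t) q0 (enum_uniq WH).
exists (maxn N 1) => n; rewrite geq_max => /andP[Nn n0].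
have n0' : 0 < n ^ #|WH| by rewrite expn_gt0 n0.
suff: rex n H F <= (n ^ #|WH|).-1 %/ q by rewrite leq_divRL //; lia.
apply/bigmax_leqP => G /andP[_ FG]; rewrite leq_divRL //; case: leqP => // dense.
case/negP: FG; apply/containsP.
have dense_emb : #|'I_n| ^ #|WH| <= q * #|embeddings H G|.
  rewrite card_ord; have := num_copies_le_embeddings H G; nia.
rewrite -(card_ord n) in Nn; have [A [A_inj]] := box _ _ Nn dense_emb.
set E1 := [set f | _]; rewrite card_ord => card_E1.
have /card_gt0P[f] : 0 < #|E1| by case: #|E1| card_E1 => //; lia.
rewrite inE => /forallP fA.
(* The box covers all coordinates, so nothing of [f] survives. *)
have emb (j : WH -> 'I_t) : [ffun v => A v (j v)] \in embeddings H G.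
  rewrite -[finfun _](_ : [ffun v => if v \in enum WH then
    A v ([ffun w => j w] v) else f v] = _) ?fA //.
  by apply/ffunP => v; rewrite !ffunE mem_enum.
pose h (x : blowup_vertex s) := A (tag x) (widen_ord (s_lt (tag x)) (tagged x)).
(* Injectivity and adjacency concern two points at a time, and points on different sides of the box
   lie on a common embedding. *)
have pick2 u a v b : exists j : WH -> 'I_t, j u = a /\ (u != v -> j v = b).
  exists (fun w => if w == u then a else b); rewrite eqxx; split=> //.
  by rewrite eq_sym => /negPf->.
have h_inj : injective h.
  move=> [u a] [v b]; rewrite /h /= => Eh; case: (eqVneq u v) => [Euv|nuv].
    move: b Eh; rewrite -Euv => b /A_inj.
    by rewrite mem_enum => /(_ isT)[/val_inj->].
  have [j [ju /(_ nuv) jv]] :=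
    pick2 u (widen_ord (s_lt u) a) v (widen_ord (s_lt v) b).
  have /embeddingP[j_inj _] := emb j.
  by case/eqP: nuv; apply: j_inj; rewrite !ffunE ju jv.
have h_hom : {homo h : x y / adj (blowup H s) x y >-> adj G x y}.
  move=> [u a] [v b]; rewrite adj_blowup /h /= => Huv.
  have nuv : u != v by apply: contraTneq Huv => ->; rewrite adj_irrefl.
  have [j [ju /(_ nuv) jv]] :=
    pick2 u (widen_ord (s_lt u) a) v (widen_ord (s_lt v) b).
  have /embeddingP[_ j_hom] := emb j.
  by have := j_hom _ _ Huv; rewrite !ffunE ju jv.
by exists (h \o g) => [|x y /g_hom/h_hom]; first exact: inj_comp.
Qed.

(** * Regular graphs with many copies *)

Definition rel_edges (V : finType) (r : rel V) : {set {set V}} :=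
  [set e : {set V} |
    [exists x, exists y, [&& x != y, r x y & e == [set x; y]]]].

Lemma rel_edges_card (V : finType) (r : rel V) :
  [forall e in rel_edges r, #|e| == 2].
Proof.
apply/forall_inP => e; rewrite inE => /existsP[x /existsP[y /and3P[nxy _ /eqP->]]].
by rewrite cards2 nxy.
Qed.

Definition rel_graph (V : finType) (r : rel V) := SGraph (rel_edges_card r).

Lemma adj_rel_graph (V : finType) (r : rel V) :
  symmetric r -> irreflexive r -> adj (rel_graph r) =2 r.
Proof.
move=> r_sym r_irr x y; rewrite /adj /= inE.
apply/existsP/idP => [[x' /existsP[y' /and3P[nxy' rxy' /eqP Exy]]] | rxy].
  have nxy : x != y.
    have := congr1 (fun e : {set V} => #|e|) Exy; rewrite !cards2 nxy'.
    by case: (x != y).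
  have := set21 x y; have := set22 x y; rewrite Exy !inE.
  move=> /orP[]/eqP Ey /orP[]/eqP Ex; move: nxy rxy'; rewrite Ex Ey ?eqxx //.
  by rewrite r_sym.
exists x; apply/existsP; exists y; rewrite rxy eqxx !andbT.
by apply: contraTneq rxy => ->; rewrite r_irr.
Qed.

(** Lets the constructions live on any finite type, by transport along [enum_val]. Freeness is asked
    as absence of homomorphisms, which is what the constructions provide. *)
Lemma rex_ge (T WH WF : finType) (r : rel T) (d m : nat)
    (H : sgraph WH) (F : sgraph WF) (e : WH -> 'I_m -> T) :
  symmetric r -> irreflexive r -> (forall x, #|[set y | r x y]| = d) ->
  (forall f : WF -> T, ~ {homo f : x y / adj F x y >-> r x y}) ->
  (forall u a v b, e u a = e v b -> u = v /\ a = b) ->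
  (forall u a v b, adj H u v -> r (e u a) (e v b)) ->
  m ^ #|WH| <= rex #|T| H F.
Proof.
move=> r_sym r_irr r_deg F_free e_inj e_adj.
pose r' : rel 'I_#|T| := fun i j => r (enum_val i) (enum_val j).
have adjE : adj (rel_graph r') =2 r'.
  by apply: adj_rel_graph => [i j|i]; [exact: r_sym | exact: r_irr].
have degE i : degree (rel_graph r') i = d.
  rewrite /degree -(r_deg (enum_val i)).
  rewrite -(card_imset _ (@enum_rank_inj T)); congr #|pred_of_set _|.
  apply/setP => j; rewrite inE adjE /r'; apply/idP/imsetP => [rij|[y + ->]].
    by exists (enum_val j); rewrite ?inE // enum_valK.
  by rewrite inE enum_rankK.
apply: leq_trans (_ : num_copies H (rel_graph r') <= _); last first.
  apply: (leq_bigmax_cond (F := fun G => num_copies H G)).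
  apply/andP; split; first by apply/forallP => i; apply/forallP => j; rewrite !degE.
  apply/containsP => -[f _ f_hom]; apply: (F_free (enum_val \o f)) => x y.
  by move=> /f_hom; rewrite adjE.
apply: (@num_copies_ge _ _ _ _ _ (fun u a => enum_rank (e u a))).
  by move=> u a v b /enum_rank_inj/e_inj.
by move=> u a v b /(e_adj _ a _ b); rewrite adjE /r' !enum_rankK.
Qed.

(* Vertices of Z/r whose difference lies within k of r/2 but is not r/2; the
   exclusion of r/2 makes the degree 2k for both parities of r. *)
Definition near_half (r k s : nat) :=
  (r < 2 * s <= r + 2 * k) || (r <= 2 * s + 2 * k) && (2 * s < r).

Definition circulant (r k : nat) : rel 'I_r :=
  fun x y => near_half r k (if y <= x then x - y else x + r - y).

(** Exchanging two distinct points turns the residue [s] into [r - s], which swaps the two ranges of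
    [near_half]. *)
Lemma circulant_sym (r k : nat) : 2 * k < r -> symmetric (@circulant r k).
Proof.
move=> kr x y; rewrite /circulant /near_half.
have := ltn_ord x; have := ltn_ord y.
by case: (ltngtP x y) => [_|_|->] //; lia.
Qed.

Lemma circulant_irr (r k : nat) : 2 * k < r -> irreflexive (@circulant r k).
Proof. by move=> kr x; rewrite /circulant /near_half leqnn; lia. Qed.

Lemma sum_ord_interval (n a b : nat) :
  \sum_(s < n) (a <= s < b) = minn n b - minn n a.
Proof.
elim: n => [|n IHn]; first by rewrite big_ord0 !min0n.
by rewrite big_ord_recr /= IHn; lia.
Qed.

(** Since [y] determines the residue of [x - y] bijectively, the degree counts the residues in
    [near_half]. *)
Lemma circulant_degree (r k : nat) (x : 'I_r) :
  2 * k < r -> #|[set y | circulant k x y]| = 2 * k.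
Proof.
case: r x => [|r] x kr; first by case: x.
pose f (y : 'I_r.+1) : 'I_r.+1 := inord (if y <= x then x - y else x + r.+1 - y).
have fE y : f y = (if y <= x then x - y else x + r.+1 - y) :> nat.
  by have xr := ltn_ord x; rewrite inordK //; case: (leqP y x); lia.
have f_inj : injective f.
  move=> y z /(congr1 val) /=; rewrite !fE => E; apply: val_inj => /=.
  have := ltn_ord x; have := ltn_ord y; have := ltn_ord z.
  by move: E; case: (leqP y x); case: (leqP z x); lia.
have -> : [set y | circulant k x y] =
          f @^-1: [set s : 'I_r.+1 | near_half r.+1 k s].
  by apply/setP => y; rewrite !inE fE.
rewrite card_preimset // -sum1_card big_mkcond /=.
(* Rounding the bounds on [2 * s] leaves two disjoint intervals of [k] integers each, whatever the
   parity. *)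
rewrite (eq_bigr (fun s : 'I_r.+1 => (r.+1./2.+1 <= s < r.+1./2.+1 + k) +
    (uphalf r.+1 - k <= s < uphalf r.+1))) => [|s _]; last first.
  by rewrite inE /near_half; case: ifP; move: (nat_of_ord s) => {}s; lia.
by rewrite big_split /= !sum_ord_interval; lia.
Qed.

(* Doubling the circle Z/r makes the endpoints of each edge at most 2k apart.
   Few points leave a gap of length 2k, at which the doubled circle can be cut
   open; which of its two halves a point lies in is then a proper colouring. *)
Lemma circulant_locally_bipartite (W : finType) (r k : nat) (f : W -> 'I_r) :
  0 < k -> #|W|.+1 * (2 * k) <= r ->
  exists col : W -> bool,
    forall x y, circulant k (f x) (f y) -> col x != col y.
Proof.
(* [g x] is the arc of length [2 * k] containing the doubled point. Points past the last arc default
   to arc 0, which is harmless because only an arc that [g] misses is used. *)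
move=> k0 rbig; pose g x : 'I_#|W|.+1 := inord ((2 * f x) %% r %/ (2 * k)).
have [i gi] : exists i, i \notin [set g x | x in W].
  apply/existsP; rewrite -negb_forall; apply/negP => /forallP all_g.
  have := leq_imset_card g W; rewrite leqNgt => /negP; apply.
  have /setP/eq_card-> : [set g x | x in W] = [set: 'I_#|W|.+1].
    by apply/setP => i; rewrite all_g inE.
  by rewrite cardsT card_ord ltnS.
pose c := i * (2 * k).
have cr : c + 2 * k <= r.
  apply: leq_trans rbig; rewrite /c -mulSnr leq_mul2r; apply/orP; right.
  exact: ltn_ord.
(* [2 * f x] runs up to [2 * r], so the empty arc lifts to two intervals. *)
have gap x : ~~ (c <= 2 * f x < c + 2 * k) && ~~ (c + r <= 2 * f x < c + r + 2 * k).
  have modE s : c <= s < c + 2 * k -> (2 * f x) %% r = s -> False.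
    move=> /andP[cs sc] E; case/negP: gi; apply/imsetP; exists x => //.
    rewrite /g E.
    have -> : s %/ (2 * k) = i.
      have -> : s = c + (s - c) by lia.
      by rewrite /c divnMDl ?muln_gt0 // divn_small ?addn0 //; rewrite -/c; lia.
    by rewrite inord_val.
  have fr := ltn_ord (f x).
  apply/andP; split; apply/negP => /andP[lo hi].
    by apply: (modE (2 * f x)); rewrite ?lo ?hi // modn_small //; lia.
  apply: (modE (2 * f x - r)); first by lia.
  rewrite -{1}[2 * f x](@subnK r); last by lia.
  by rewrite modnDr modn_small //; lia.
(* Outside the gaps, doubled values of equal colour differ by less than [r - 2 * k] or by more than
   [r + 2 * k], which no edge allows. *)
exists (fun x => c <= 2 * f x < c + r) => x y.
have /andP[] := gap x; have /andP[] := gap y.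
have := ltn_ord (f x); have := ltn_ord (f y).
rewrite /circulant /near_half; clearbody c.
by move: (nat_of_ord (f x)) (nat_of_ord (f y)) => a b; case: ifP; lia.
Qed.

(** * Regular completion of a blow-up *)

Lemma card_set_sum (A B : finType) (p : pred (A + B)) :
  #|[set x | p x]| = #|[set a | p (inl a)]| + #|[set b | p (inr b)]|.
Proof.
rewrite -!sum1dep_card big_sumType /=.
by congr (_ + _); apply: eq_bigl => x; rewrite inE.
Qed.

Section Regularization.
Variables (W : finType) (H : sgraph W) (m : nat).
Let D := #|W|.

(* D disjoint copies of the m-fold blow-up of H, and for each v a pool of
   m * (D - deg v) new vertices, each joined to all copies of v: every vertex
   then has degree m * D. *)
Definition reg_vertex : finType :=
  ((W * ('I_D * 'I_m)) + {v : W & 'I_(m * (D - degree H v))})%type.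

Definition reg_rel : rel reg_vertex := fun x y =>
  match x, y with
  | inl (u, (i, _)), inl (v, (j, _)) => adj H u v && (i == j)
  | inl (u, _), inr z => u == tag z
  | inr z, inl (u, _) => u == tag z
  | inr _, inr _ => false
  end.

Lemma reg_sym : symmetric reg_rel.
Proof.
by move=> [[u [i a]]|z] [[v [j b]]|z'] //=; rewrite adj_sym eq_sym.
Qed.

Lemma reg_irr : irreflexive reg_rel.
Proof. by move=> [[u [i a]]|z] //=; rewrite adj_irrefl. Qed.

Lemma degree_leq (u : W) : degree H u <= D.
Proof. exact: max_card. Qed.

(** The pool of [u] supplies the missing [m * (D - degree H u)] neighbours, and a pool vertex
    reaches degree [m * D] because there are [D] copies of the blow-up. *)
Lemma reg_degree (x : reg_vertex) : #|[set y | reg_rel x y]| = m * D.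
Proof.
rewrite card_set_sum; case: x => [[u [i a]]|z] /=.
  have -> : [set p : W * ('I_D * 'I_m) |
      let '(v, (j, _)) := p in adj H u v && (i == j)] =
      setX [set v | adj H u v] (setX [set i] [set: 'I_m]).
    by apply/setP => -[v [j b]]; rewrite !inE andbT [j == i]eq_sym.
  rewrite !cardsX cards1 cardsT card_ord mul1n -/(degree H u).
  pose pool v : finType := 'I_(m * (D - degree H v)).
  have -> : [set z : {v : W & pool v} | u == tag z] =
            [set Tagged pool j | j : pool u].
    apply/setP => -[v j]; rewrite inE /=.
    apply/eqP/imsetP => [uv|[j' _ /(congr1 tag)] //].
    by move: j; rewrite -uv => j; exists j.
  rewrite card_imset => [|j j' /eqP]; last by rewrite eq_Tagged => /eqP.
  rewrite card_ord.
  by have := degree_leq u; rewrite -/D; nia.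
have -> : [set p : W * ('I_D * 'I_m) | let '(u, _) := p in u == tag z] =
    setX [set tag z] (setX [set: 'I_D] [set: 'I_m]).
  by apply/setP => -[v [j b]]; rewrite !inE !andbT.
rewrite !cardsX cards1 !cardsT !card_ord mul1n.
by rewrite (_ : [set _ | false] = set0) ?cards0 ?addn0 1?mulnC.
Qed.

Lemma card_reg_vertex :
  #|reg_vertex| = m * (D * D + \sum_v (D - degree H v)).
Proof.
rewrite card_sum !card_prod !card_ord mulnDr big_distrr /=; congr (_ + _).
  by rewrite mulnA mulnC.
rewrite card_tagged sumnE big_map big_enum /=.
by apply: eq_bigr => v _; rewrite card_ord.
Qed.

(* An isolated vertex is sent to the first end of the given edge ab, and its
   pool to the second. *)
Lemma reg_hom (a b : W) : adj H a b ->
  exists h : reg_vertex -> W, {homo h : x y / reg_rel x y >-> adj H x y}.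
Proof.
move=> ab.
pose lv v := if [pick w | adj H v w] is Some _ then v else a.
pose nb v := if [pick w | adj H v w] is Some w then w else b.
have lv_nb v : adj H (lv v) (nb v).
  by rewrite /lv /nb; case: pickP.
have lvE u v : adj H u v -> lv u = u.
  by move=> uv; rewrite /lv; case: pickP => // /(_ v); rewrite uv.
exists (fun x => match x with inl (v, _) => lv v | inr z => nb (tag z) end).
move=> [[u [i c]]|z] [[v [j d]]|z'] //=.
- by move=> /andP[uv _]; rewrite (lvE _ _ uv) (lvE v u) // adj_sym.
- by move=> /eqP->.
- by move=> /eqP->; rewrite adj_sym.
Qed.

End Regularization.

(** * Disjoint unions and the lower bound *)

Definition sum_rel (A B : finType) (r : rel A) (r' : rel B) : rel (A + B) :=
  fun x y => match x, y with
  | inl a, inl a' => r a a'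
  | inr b, inr b' => r' b b'
  | _, _ => false
  end.

Lemma sum_rel_degree (A B : finType) (r : rel A) (r' : rel B) (d : nat) :
  (forall a, #|[set a' | r a a']| = d) ->
  (forall b, #|[set b' | r' b b']| = d) ->
  forall x, #|[set y | sum_rel r r' x y]| = d.
Proof.
have set_false (C : finType) : #|[set _ : C | false]| = 0.
  by rewrite -sum1dep_card big_pred0.
by move=> rd r'd [a|b]; rewrite card_set_sum /= set_false ?addn0 ?rd ?r'd.
Qed.

(** If [F] had no edge, any map to [H] would be a homomorphism. So [F] has an edge, and the edgeless
    graph on [n] vertices avoids it. *)
Lemma rex_large_edgeless (WH WF : finType) (H : sgraph WH) (F : sgraph WF) :
  0 < #|WH| -> (forall u v, ~~ adj H u v) ->
  (forall h : WF -> WH, ~ {homo h : x y / adj F x y >-> adj H x y}) ->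
  exists C N, forall n, N <= n -> n ^ #|WH| <= C * rex n H F.
Proof.
set k := #|WH| => k0 H_edgeless F_hom.
exists ((2 * k) ^ k), k => n kn; pose m := n %/ k.
have nE : n = k * m + n %% k by rewrite mulnC /m -divn_eq.
have nk := ltn_pmod n k0.
have m0 : 0 < m by rewrite divn_gt0.
pose T : finType := ((WH * 'I_m) + 'I_(n %% k))%type.
have cardT : #|T| = n by rewrite card_sum card_prod !card_ord -/k -nE.
have := @rex_ge T WH WF (fun _ _ => false) 0 m H F (fun v a => inl (v, a)).
rewrite cardT => rex_m.
(* As [m] is positive, [n < k * m.+1 <= 2 * k * m]. *)
apply: leq_trans (_ : (2 * k) ^ k * m ^ k <= _).
  by rewrite -expnMn leq_exp2r //; nia.
rewrite leq_mul2l rex_m ?orbT //.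
- by move=> x; rewrite -sum1dep_card big_pred0.
- move=> f f_hom; have /card_gt0P[v _] := k0.
  by apply: (F_hom (fun _ => v)) => x y /f_hom.
- by move=> u a v b [-> ->].
- by move=> u a v b; rewrite (negPf (H_edgeless u v)).
Qed.

Lemma rex_large_edge (WH WF : finType) (H : sgraph WH) (F : sgraph WF)
    (a b : WH) :
  adj H a b ->
  (forall h : WF -> WH, ~ {homo h : x y / adj F x y >-> adj H x y}) ->
  exists C N, forall n, N <= n -> n ^ #|WH| <= C * rex n H F.
Proof.
move=> ab F_hom; set D := #|WH|.
have D0 : 0 < D by apply/card_gt0P; exists a.
pose K := D * D + \sum_v (D - degree H v).
(* Vertices needed per unit of [m]: [K] for the completed blow-up, the rest for a circulant long
   enough to be bipartite on any [#|WF|] points. *)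
pose M := K + #|WF|.+1 * D.
have M0 : 0 < M by rewrite /M; nia.
exists ((2 * M) ^ D), (2 * M) => n Mn.
(* [m] is even so that the degree [m * D] is [2 * (q * D)], the degree of a circulant. *)
pose q := n %/ (2 * M); pose m := 2 * q; pose r := n - m * K.
have q0 : 0 < q by rewrite divn_gt0 //; lia.
have mMn : m * M <= n.
  by apply: leq_trans (leq_trunc_div n (2 * M)); rewrite /m -/q; lia.
have nmM : n <= 2 * M * m.
  have := ltn_ceil n (_ : 0 < 2 * M); rewrite -/q /m => /(_ ltac:(lia)); nia.
have rbig : #|WF|.+1 * (2 * (q * D)) <= r.
  by move: mMn; rewrite /r /M /m mulnDr; lia.
have k0 : 0 < q * D by rewrite muln_gt0 q0.
have WF0 : 0 < #|WF|.
  rewrite lt0n; apply/negP => /eqP WF0.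
  by apply: (F_hom (fun _ => a)) => x; have := card0_eq WF0 x.
have kr : 2 * (q * D) < r by apply: leq_trans rbig; nia.
pose T : finType := (reg_vertex H m + 'I_r)%type.
pose rT : rel T := sum_rel (@reg_rel WH H m) (@circulant r (q * D)).
have cardT : #|T| = n.
  rewrite card_sum card_reg_vertex card_ord -/K /r subnKC //.
  by apply: leq_trans mMn; rewrite leq_mul2l leq_addr orbT.
pose i0 : 'I_D := Ordinal D0.
pose s0 : 'I_r := Ordinal (leq_ltn_trans (leq0n _) kr).
have := @rex_ge T WH WF rT (m * D) m H F (fun v c => inl (inl (v, (i0, c)))).
rewrite cardT -/D => rex_m.
apply: leq_trans (_ : (2 * M) ^ D * m ^ D <= _).
  by rewrite -expnMn leq_exp2r.
rewrite leq_mul2l rex_m ?orbT //.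
- by move=> [x|x] [y|y] //=; [exact: reg_sym | exact: circulant_sym].
- by move=> [x|x] /=; [exact: reg_irr | exact: circulant_irr].
- apply: sum_rel_degree => x; first exact: reg_degree.
  by rewrite circulant_degree // mulnA.
- move=> f f_hom; have [h h_hom] := reg_hom m ab.
  (* The dummy [s0] stands for vertices mapped outside the circulant; their colour is never
     consulted, as no edge joins the two components. *)
  pose g x := if f x is inr s then s else s0.
  have [col col_proper] := circulant_locally_bipartite g k0 rbig.
  apply: (F_hom (fun x => match f x with
    | inl y => h y | inr _ => if col x then a else b end)) => x y /f_hom.
  have := col_proper x y; rewrite /g.
  case: (f x) (f y) => [x'|s] [y'|s'] //= col_xy; first by move=> /h_hom.
  by move=> /col_xy; case: (col x) (col y) => [] [] // _; rewrite adj_sym.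
- by move=> u c v d [-> ->].
- by move=> u c v d uv /=; rewrite uv eqxx.
Qed.

Lemma rex_large (WH WF : finType) (H : sgraph WH) (F : sgraph WF) :
  0 < #|WH| ->
  (forall h : WF -> WH, ~ {homo h : x y / adj F x y >-> adj H x y}) ->
  exists C N, forall n, N <= n -> n ^ #|WH| <= C * rex n H F.
Proof.
move=> H0 F_hom; case: (boolP [exists u, exists v, adj H u v]).
  by move=> /existsP[a /existsP[b ab]]; apply: rex_large_edge F_hom; exact: ab.
move=> /existsPn noE; apply: rex_large_edgeless F_hom => // u v.
by move/existsPn: (noE u); apply.
Qed.

(** Every part has room for all of [F], so vertices with the same image are separated by their
    rank. *)
Lemma hom_contains_blowup (WH WF : finType) (H : sgraph WH) (F : sgraph WF)
    (h : WF -> WH) :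
  {homo h : x y / adj F x y >-> adj H x y} ->
  contains (blowup H (fun _ => #|WF|.+1)) F.
Proof.
move=> h_hom; apply/containsP.
exists (fun x => existT _ (h x) (inord (enum_rank x)) :
                 blowup_vertex (fun _ => #|WF|.+1)).
  move=> x y /(congr1 (fun z => nat_of_ord (tagged z))) /=.
  by rewrite !inordK ?ltnS 1?ltnW // => /val_inj/enum_rank_inj.
by move=> x y /h_hom; rewrite adj_blowup.
Qed.

(* The asymptotic equivalence over the reals *)
From mathcomp Require Import all_order all_algebra.
From mathcomp Require Import all_classical all_reals all_analysis.
Import Order.TTheory GRing.Theory Num.Theory numFieldNormedType.Exports.
Local Open Scope classical_set_scope.
Local Open Scope ring_scope.

Theorem theorem1p2 (R : realType) (WF WH : finType)
    (F : sgraph WF) (H : sgraph WH) (H_nonempty : (0 < #|WH|)%N) :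
  (fun n : nat => (rex n H F)%:R : R^o)
    =Theta_\oo (fun n : nat => n%:R ^+ #|WH| : R^o)
  <->
  ~ (exists s : WH -> nat,
       (forall v : WH, (0 < s v)%N) /\ contains (blowup H s) F).
Proof.
rewrite eqThetaE qualifE; split.
  move=> /asboolP[[c1 c2] /= /andP[c1_gt0 _] [N _ bound]] [s [_ FHs]].
  (* [q] exceeds [1 / c1], so the bound of [rex_small] contradicts the lower Theta bound. *)
  pose q := (Num.truncn c1^-1).+1.
  have qc1 : 1 <= q%:R * c1.
    by rewrite -ler_pdivrMr // mul1r ltW // truncnS_gt.
  have [N' small] := rex_small FHs (ltn0Sn _ : (0 < q)%N).
  pose n := maxn N N'.
  have [+ _] := bound n (leq_maxl _ _).
  have := small n (leq_maxr _ _); rewrite -(ltr_nat R) natrM natrX.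
  rewrite normrX !normr_nat => lt_q le_c1.
  have: q%:R * (c1 * n%:R ^+ #|WH|) < n%:R ^+ #|WH|.
    by apply: le_lt_trans lt_q; rewrite ler_pM2l // ltr0n.
  by rewrite mulrA ltNge ler_peMl // exprn_ge0.
move=> no_blowup; have [|C [N large]] := @rex_large _ _ H F H_nonempty.
  by move=> h /hom_contains_blowup FH; apply: no_blowup; exists (fun _ => #|WF|.+1).
(* The successor keeps the lower constant positive even for [C = 0]; the upper constant 1 comes from
   [rex_le]. *)
apply/asboolP; exists (C.+1%:R^-1, 1) => /=; first by rewrite invr_gt0 ltr0n ltr01.
exists N => // n /= Nn; rewrite normrX !normr_nat mul1r.
rewrite ler_pdivrMl ?ltr0n // -natrX -natrM !ler_nat rex_le; split=> //.
by apply: leq_trans (large n Nn) _; rewrite leq_mul2r leqnSn orbT.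
Qed.
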